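(* Let $p$ be a prime and $s$ a positive integer, and let $E'_{\max}(p^s):=\frac{E_{\max}(p^s)}{2(p-1)p^{s-1}}$. (i) We have $$\underline{C}\cdot(s-1)\Big(1-\frac{\log\log p}{\log p}\Big)\le E'_{\max}(p^s)\le\overline{C}\cdot(s-1)\Big(1-\frac{\log\log p}{\log p}\Big)+1,$$ where $\overline{C}=1$ for all $p\ge3$, and $\underline{C}=\frac12$ for all $p\ge17$ as well as for $3\le p\le13$ in case $s\le6$. For $p=2$ one has $\overline{C}=0.328$ and $\underline{C}=0.118$; and for $3\le p\le 13$ in case $s\ge7$ one has $\underline{C}=0.030$ if $p=3$, $0.233$ if $p=5$, $0.337$ if $p=7$, $0.442$ if $p=11$, $0.473$ if $p=13$. (ii) Let $D(p):=4.09184$ for $p=2$ and $D(p):=2\big(1+\frac{\log\log p}{\log p}\big)$ for $p\ge3$, and let $r_0$ be the integer with $\frac{s-1}{D(p)}\le r_0<\frac{s-1}{D(p)}+1$. Define $\mathcal{D}_0:=\{p^{\|\alpha_j(s-1,r_0)\|}: j=1,\ldots,r_0\}$, where $\|\cdot\|$ denotes the nearest integer. For $p=2$, $s\ge11$ and for $p\ge3$, $s\ge7$, the quantity $\frac{E_{p^s}(\mathcal{D}_0)}{2(p-1)p^{s-1}}$ lies in the same interval as the one established for $E'_{\max}(p^s)$ in (i).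
   Context: $\log$ is the natural logarithm. For a positive integer $n$ and a set $\mathcal{D}$ of positive divisors of $n$ with $n\notin\mathcal{D}$, the integral circulant (gcd) graph $\mathrm{ICG}_n(\mathcal{D})$ has vertex set $\mathbb{Z}_n$ and edge set $\{\{a,b\}: a,b\in\mathbb{Z}_n,\ \gcd(a-b,n)\in\mathcal{D}\}$. The energy of a graph is the sum of the absolute values of the eigenvalues of its adjacency matrix; $E_n(\mathcal{D})$ denotes the energy of $\mathrm{ICG}_n(\mathcal{D})$, and $E_{\max}(n):=\max\{E_n(\mathcal{D}):\ \mathcal{D}\subseteq\{1\le d<n: d\mid n\}\}$. For integers $r\ge3$ and $s$ with $s-1\ge (r-1)\log2/\log p$: let $\tilde{\nu}$ be the unique real solution $x\in[0,1]$ of $p^{s-1}x^{r-1}=(1-x)^2$, $\tilde{\mu}:=\tilde{\nu}/(1-\tilde{\nu})$, and set $\alpha_1(s-1,r):=0$, $\alpha_r(s-1,r):=s-1$, and $\alpha_j(s-1,r):=\frac{\log(1/\tilde{\mu})}{\log p}+(j-2)\frac{\log(1/\tilde{\nu})}{\log p}$ for $2\le j\le r-1$. *)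

(* Defs.v *)
From HB Require Import structures.
From mathcomp Require Import all_boot all_order all_algebra.
From mathcomp Require Import finmap.
From mathcomp Require Import all_classical all_reals all_analysis.

Set Implicit Arguments.
Unset Strict Implicit.
Unset Printing Implicit Defensive.

Import Order.TTheory GRing.Theory Num.Theory.

Local Open Scope classical_set_scope.
Local Open Scope ring_scope.

(* Z_n is represented by the residues 0, ..., n - 1. The gcd of a difference
   with n depends only on the residue classes and not on the sign. *)
Definition icg (n : nat) (D : {fset nat}) : rel 'I_n :=
  fun a b => gcdn `|(a : nat)%:Z - (b : nat)%:Z|%N n \in D.

Definition adjacency_mx (R : realType) (n : nat) (e : rel 'I_n) : 'M[R]_n :=
  \matrix_(i, j) (e i j)%:R.

(* The sum runs over the distinct real eigenvalues, each one weighted by its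
   algebraic multiplicity. For a symmetric matrix these are all the
   eigenvalues. *)
Definition graph_energy (R : realType) (n : nat) (e : rel 'I_n) : R :=
  let A := adjacency_mx R e in
  \sum_(x \in [set x : R | eigenvalue A x]) `|x| *+ mup x (char_poly A).

Definition icg_energy (R : realType) (n : nat) (D : {fset nat}) : R :=
  graph_energy R (icg (n := n) D).

Definition proper_divisors (n : nat) : {fset nat} :=
  [fset d in divisors n | (d < n)%N]%fset.

(* Energies are nonnegative, so the default value 0 of the iterated maximum is
   harmless. *)
Definition max_energy (R : realType) (n : nat) : R :=
  \big[Num.max/0]_(D <- fpowerset (proper_divisors n)) icg_energy R n D.

Definition normalize (R : realType) (p s : nat) (x : R) : R :=
  x / (2 * (p%:R - 1) * p%:R ^+ s.-1).

Definition loglog_ratio (R : realType) (p : nat) : R :=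
  ln (ln p%:R) / ln p%:R.

Definition C_upper (R : realType) (p : nat) : R :=
  if p == 2%N then 328 / 1000 else 1.

(* Used only for p prime: the last branch is p = 13. *)
Definition C_lower (R : realType) (p s : nat) : R :=
  if p == 2%N then 118 / 1000
  else if (17 <= p)%N || (s <= 6)%N then 1 / 2
  else if p == 3%N then 30 / 1000
  else if p == 5%N then 233 / 1000
  else if p == 7%N then 337 / 1000
  else if p == 11%N then 442 / 1000
  else 473 / 1000.

Definition in_energy_interval (R : realType) (p s : nat) (x : R) : Prop :=
  C_lower R p s * (s.-1%:R * (1 - loglog_ratio R p)) <= x /\
  x <= C_upper R p * (s.-1%:R * (1 - loglog_ratio R p)) + 1.

(* The constant for p = 2 is 4.09184, split up to avoid a large unary numeral. *)
Definition D_const (R : realType) (p : nat) : R :=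
  if p == 2%N then 4 + 91 / 10 ^+ 3 + 84 / 10 ^+ 5 else 2 * (1 + loglog_ratio R p).

(* In the following three definitions m stands for s - 1. *)
Definition nu_tilde (R : realType) (p m r : nat) : R :=
  xget 0 [set x : R | 0 <= x <= 1 /\ p%:R ^+ m * x ^+ r.-1 = (1 - x) ^+ 2].

Definition mu_tilde (R : realType) (p m r : nat) : R :=
  nu_tilde R p m r / (1 - nu_tilde R p m r).

Definition alpha (R : realType) (p m r j : nat) : R :=
  if j == 1%N then 0
  else if j == r then m%:R
  else ln (1 / mu_tilde R p m r) / ln p%:R
       + (j%:R - 2) * (ln (1 / nu_tilde R p m r) / ln p%:R).

(* Ties do occur: for r odd and m odd the middle alpha is m / 2. This property
   leaves the choice between the two nearest integers open. *)
Definition nearest_integer (R : realType) (rnd : R -> int) : Prop :=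
  forall (x : R) (z : int), `|x - (rnd x)%:~R| <= `|x - z%:~R|.

(* The alphas lie between 0 and m, and so do their roundings; taking absolute
   values only converts from int to nat. *)
Definition D0 (R : realType) (rnd : R -> int) (p m r : nat) : {fset nat} :=
  [fset (p ^ `|rnd (alpha R p m r j)|)%N | j in iota 1 r]%fset.

(* Main.v *)
Require Import Defs.
From mathcomp Require Import all_boot all_order all_algebra.
From mathcomp Require Import finmap.
From mathcomp Require Import all_classical all_reals all_analysis.
From mathcomp Require Import ring lra zify.
Set Implicit Arguments.
Unset Strict Implicit.
Unset Printing Implicit Defensive.
Import Order.TTheory GRing.Theory Num.Theory.
Local Open Scope ring_scope.

(* For c a := (p ^ a \in D) the adjacency matrix lies in the span of the
   averaging projectors onto the functions on Z / p ^ s that are periodic modulo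
   p ^ a. These form a chain, whose successive differences are orthogonal
   idempotents, and this gives the spectrum. The normalized energy becomes
     \sum_a c a * (1 - (p - 1) * \sum_(k < a) c k * p ^ (k - a)).
   Adding the exponents one or two at a time bounds it by (s + 1) / 2. If
   consecutive exponents differ by at least g, the inner sum is at most
   1 / (p ^ g - 1). The even exponents (g = 2) give the lower bound in (i). In
   (ii), r0 - 1 < (s - 1) / D forces nu < p ^ (- D), small enough that all gaps
   between consecutive alphas exceed g = 2 (g = 3 if p = 2); the gaps between
   their roundings are then at least g. *)

(** * Spectral resolutions, characteristic polynomials and graph energy *)

Lemma det_add1_mulmx (R : comPzRingType) (m n : nat)
    (U : 'M[R]_(m, n)) (V : 'M[R]_(n, m)) :
  \det (1%:M + U *m V) = \det (1%:M + V *m U).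
Proof.
(* One block matrix, multiplied by two different unitriangular matrices, becomes block triangular
   with the one or the other determinant. *)
have e1 : block_mx 1%:M (- U) V 1%:M *m block_mx 1%:M U 0 1%:M =
    block_mx 1%:M 0 V (1%:M + V *m U).
  by rewrite mulmx_block !mulmx0 !mul1mx !mulmx1 !addr0 addrN addrC.
have e2 : block_mx 1%:M (- U) V 1%:M *m block_mx 1%:M 0 (- V) 1%:M =
    block_mx (1%:M + U *m V) (- U) 0 1%:M.
  by rewrite mulmx_block !mulmx0 !mul1mx !mulmx1 mulNmx mulmxN opprK !add0r addrN.
move: (congr1 determinant e1) (congr1 determinant e2).
rewrite !det_mulmx !(det_lblock, det_ublock) !det1 !mulr1 !mul1r.
by move=> -> ->.
Qed.

(** With the full-rank factorization E = C B, cancel C on the left and B on the right in C B C B = C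
    B. *)
Lemma idempotent_base (F : fieldType) (n : nat) (E : 'M[F]_n) :
  E *m E = E -> row_base E *m col_base E = 1%:M.
Proof.
move=> EE; apply: (row_full_inj (col_base_full E)).
apply: (row_free_inj (row_base_free E)).
by rewrite /= mulmx1 (mulmxA (col_base E)) mulmx_base -mulmxA mulmx_base EE.
Qed.

Lemma mxtrace_idempotent (F : fieldType) (n : nat) (E : 'M[F]_n) :
  E *m E = E -> \tr E = (\rank E)%:R.
Proof.
by move=> EE; rewrite -{1}(mulmx_base E) mxtrace_mulC idempotent_base // mxtrace1.
Qed.

(** Through the full-rank factorization of [E], [det_add1_mulmx] reduces the determinant to that of
    the scalar matrix 1 + t of size [\rank E]. *)
Lemma det_add1_idempotent (F : fieldType) (n : nat) (E : 'M[F]_n)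
    (t : {poly F}) :
  E *m E = E ->
  \det (1%:M + t *: map_mx polyC E) = (1 + t) ^+ (\rank E).
Proof.
move=> EE; rewrite -{1}(mulmx_base E) map_mxM scalemxAl det_add1_mulmx.
rewrite -scalemxAr -map_mxM idempotent_base // map_mx1 scalemx1 -raddfD.
by rewrite det_scalar.
Qed.

(** As the [Q i] sum to 1, the characteristic matrix is 1 + sum_i (X - l_i - 1) Q_i. By
    orthogonality this is the product of the matrices [M i], whose determinants are known. *)
Lemma char_poly_spectral (F : fieldType) (n k : nat) (Q : 'I_k -> 'M[F]_n)
    (l : 'I_k -> F) :
  (forall i, Q i *m Q i = Q i) ->
  (forall i j, i != j -> Q i *m Q j = 0) ->
  \sum_i Q i = 1%:M ->
  char_poly (\sum_i l i *: Q i) = \prod_i ('X - (l i)%:P) ^+ \rank (Q i).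
Proof.
move=> Qid Qorth Qsum.
pose M i := 1%:M + ('X - (l i)%:P - 1) *: map_mx polyC (Q i).
have prodM (r : seq 'I_k) : uniq r -> \big[mulmx/1%:M]_(i <- r) M i =
    1%:M + \sum_(i <- r) ('X - (l i)%:P - 1) *: map_mx polyC (Q i).
  elim: r => [|i r IHr]; first by rewrite !big_nil addr0.
  move=> /andP[ir ur]; rewrite !big_cons IHr // mulmxDr mulmx1 mulmxDl mul1mx.
  rewrite -addrA; congr (_ + _); rewrite mulmx_sumr [X in _ + (_ + X)]big_seq.
  rewrite [X in _ + (_ + X)]big1 ?addr0 // => j jr.
  rewrite -scalemxAl -scalemxAr -map_mxM Qorth ?map_mx0 ?scaler0 //.
  by apply: contraNneq ir => ->.
have detM (r : seq 'I_k) :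
    \det (\big[mulmx/1%:M]_(i <- r) M i) = \prod_(i <- r) \det (M i).
  elim: r => [|i r IHr]; first by rewrite !big_nil det1.
  by rewrite !big_cons det_mulmx IHr.
rewrite /char_poly /char_poly_mx.
have -> : 'X%:M - map_mx polyC (\sum_i l i *: Q i) =
    \big[mulmx/1%:M]_(i <- index_enum 'I_k) M i.
  rewrite prodM ?index_enum_uniq // -(scalemx1 _ 'X) -(map_mx1 polyC) -Qsum.
  rewrite !(raddf_sum (map_mx polyC)) scaler_sumr -sumrB -big_split /=.
  by apply: eq_bigr => i _; rewrite map_mxZ !scalerBl scale1r addrC subrK.
rewrite detM; apply: eq_bigr => i _.
by rewrite /M det_add1_idempotent // addrC subrK.
Qed.

Lemma mup_prod_XsubC (F : fieldType) (k : nat) (l : 'I_k -> F) (n : 'I_k -> nat)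
    (x : F) :
  mup x (\prod_i ('X - (l i)%:P) ^+ n i) = (\sum_(i | l i == x) n i)%N.
Proof.
rewrite [RHS]big_mkcond /=.
elim: (index_enum _) => [|i r IHr].
  by rewrite !big_nil mupNroot // rootE hornerC oner_eq0.
have nz j : ('X - (l j)%:P) ^+ n j != 0 by rewrite expf_neq0 // polyXsubC_eq0.
rewrite !big_cons mupM ?nz ?mup_XsubCX ?IHr // prodf_seq_neq0.
by apply/allP => j _; rewrite nz.
Qed.

Lemma graph_energy_spectral (R : realType) (n k : nat) (e : rel 'I_n)
    (Q : 'I_k -> 'M[R]_n) (l : 'I_k -> R) :
  (forall i, Q i *m Q i = Q i) ->
  (forall i j, i != j -> Q i *m Q j = 0) ->
  \sum_i Q i = 1%:M ->
  adjacency_mx R e = \sum_i l i *: Q i ->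
  graph_energy R e = \sum_i \tr (Q i) * `|l i|.
Proof.
move=> Qid Qorth Qsum eQ; rewrite /graph_energy.
have mupE x : mup x (char_poly (adjacency_mx R e)) =
    (\sum_(i | l i == x) \rank (Q i))%N.
  by rewrite eQ char_poly_spectral // mup_prod_XsubC.
have eigE x : eigenvalue (adjacency_mx R e) x =
    (0 < mup x (char_poly (adjacency_mx R e)))%N.
  by rewrite eigenvalue_root_char -XsubC_dvd ?dvdp_XsubCl // monic_neq0 ?char_poly_monic.
(* The sum may run over all values of [l]: those that are not eigenvalues have multiplicity 0. *)
rewrite (fsbig_widen _ [set` undup (codom l)]%classic); first last.
- by move=> x [_ /= /negP]; rewrite eigE lt0n negbK => /eqP ->; rewrite mulr0n.
- move=> x /=; rewrite eigE mupE mem_undup.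
  apply: contraLR => xl; rewrite -leqNgt leqn0 big1 // => i /eqP ix.
  by rewrite -ix codom_f in xl.
rewrite -fsbig_seq ?undup_uniq //.
under eq_bigr => x _ do rewrite mupE -sumrMnr.
rewrite (exchange_big_dep xpredT) //=.
apply: eq_bigr => i _; rewrite mxtrace_idempotent // mulr_natl.
rewrite (big_rem (l i)) /= ?mem_undup ?codom_f // eqxx big_seq_cond.
rewrite big1 ?addr0 // => x; rewrite mem_rem_uniq ?undup_uniq // !inE.
by rewrite eq_sym => /andP[/andP[/negP]].
Qed.

(** * Averaging over residue classes *)

Lemma count_congruent (d q k : nat) :
  (0 < d)%N -> (\sum_(j < d * q) (j == k %[mod d]) = q)%N.
Proof.
move=> d0; elim: q => [|q IHq]; first by rewrite muln0 big_ord0.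
rewrite mulnSr big_split_ord /= IHq -addn1; congr (_ + _)%N.
have kd : (k %% d < d)%N by rewrite ltn_pmod.
rewrite (bigD1 (Ordinal kd)) //= mulnC modnMDl modn_mod eqxx big1 // => i.
rewrite modnMDl (modn_small (ltn_ord i)) => /negPf; rewrite -val_eqE /= => -> //.
Qed.

Section CongruenceProjector.
Variables (R : numFieldType) (n : nat).
Hypothesis n_gt0 : (0 < n)%N.

Definition congruence_proj (d : nat) : 'M[R]_n :=
  \matrix_(i, j) (d%:R / n%:R * (i == j %[mod d])%:R).

Let nR_neq0 : n%:R != 0 :> R.
Proof. by rewrite pnatr_eq0 -lt0n. Qed.

(** In the entry (i, k) only the j congruent to k modulo [d'] count. They lie in the class of k
    modulo [d] as well, and there are [n %/ d'] of them. *)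
Lemma congruence_proj_mul (d d' : nat) :
  (d %| d')%N -> (d' %| n)%N ->
  congruence_proj d *m congruence_proj d' = congruence_proj d.
Proof.
move=> dd' d'n; apply/matrixP => i k; rewrite !mxE.
have d'0 : (0 < d')%N by apply: dvdn_gt0 d'n.
transitivity (d%:R / n%:R * (i == k %[mod d])%:R * (d'%:R / n%:R) *
    (\sum_(j < n) (j == k %[mod d'])%N)%:R : R).
  rewrite natr_sum mulr_sumr; apply: eq_bigr => j _; rewrite !mxE.
  have [jk|_] := eqVneq (j %% d')%N (k %% d')%N; last by rewrite !mulr0.
  suff -> : (i == j %[mod d]) = (i == k %[mod d]) by ring.
  by rewrite -(modn_dvdm j dd') jk modn_dvdm.
have -> : (\sum_(j < n) (j == k %[mod d']) = n %/ d')%N.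
  by rewrite -[in X in _ = X](count_congruent (n %/ d') k d'0) mulnC divnK.
rewrite -mulrA [_ * (n %/ d')%:R]mulrAC -natrM mulnC divnK // divff // mulr1 //.
Qed.

Lemma congruence_proj_tr (d : nat) : (congruence_proj d)^T = congruence_proj d.
Proof. by apply/matrixP => i j; rewrite !mxE eq_sym. Qed.

Lemma congruence_proj_mulr (d d' : nat) :
  (d %| d')%N -> (d' %| n)%N ->
  congruence_proj d' *m congruence_proj d = congruence_proj d.
Proof.
move=> dd' d'n; apply: trmx_inj; rewrite trmx_mul !congruence_proj_tr.
exact: congruence_proj_mul.
Qed.

Lemma congruence_proj_id : congruence_proj n = 1%:M.
Proof.
apply/matrixP => i j; rewrite !mxE divff // mul1r !modn_small ?ltn_ord //.
Qed.

Lemma mxtrace_congruence_proj (d : nat) : \tr (congruence_proj d) = d%:R.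
Proof.
rewrite /mxtrace; under eq_bigr => i _ do rewrite mxE eqxx mulr1.
by rewrite sumr_const card_ord -[LHS]mulr_natr divfK.
Qed.

End CongruenceProjector.

(** * The chain of projectors for a prime power and its layers *)

Section PrimePower.
Variables (R : realType) (p s : nat).
Hypothesis p_prime : prime p.
Let n := (p ^ s)%N.
Let p_gt0 : (0 < p)%N := prime_gt0 p_prime.
Let n_gt0 : (0 < n)%N. Proof. by rewrite expn_gt0 p_gt0. Qed.

(** The index is shifted by one to make room for 0 at the bottom: layer 0 is then the projector onto
    the constants, and the layers 0, ..., s telescope to the identity. *)
Definition chain_proj (b : nat) : 'M[R]_n :=
  if b is b'.+1 then congruence_proj R n (p ^ b') else 0.

Definition layer_proj (b : nat) : 'M[R]_n := chain_proj b.+1 - chain_proj b.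

Lemma chain_proj_mul (a b : nat) :
  (a <= b <= s.+1)%N ->
  chain_proj a *m chain_proj b = chain_proj a /\
  chain_proj b *m chain_proj a = chain_proj a.
Proof.
case: a b => [|a] [|b] //=; rewrite ?mul0mx ?mulmx0 // !ltnS => /andP[ab bs].
have [d1 d2] : (p ^ a %| p ^ b)%N /\ (p ^ b %| n)%N by rewrite !dvdn_exp2l.
by rewrite congruence_proj_mul ?congruence_proj_mulr.
Qed.

Lemma layer_proj_idem (b : nat) :
  (b <= s)%N -> layer_proj b *m layer_proj b = layer_proj b.
Proof.
move=> bs; rewrite /layer_proj mulmxBl !mulmxBr.
have [|_ ->] := chain_proj_mul (a := b.+1) (b := b.+1); first by rewrite ?leqnn.
have [|-> ->] := chain_proj_mul (a := b) (b := b.+1); first by rewrite ?leqnSn.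
have [|_ ->] := chain_proj_mul (a := b) (b := b); first by rewrite ?leqnn ?leqW.
by rewrite subrr subr0.
Qed.

Lemma layer_proj_orth (a b : nat) :
  (a < b <= s)%N ->
  layer_proj a *m layer_proj b = 0 /\ layer_proj b *m layer_proj a = 0.
Proof.
move=> /andP[ab bs]; rewrite /layer_proj !mulmxBl !mulmxBr.
have [|-> ->] := chain_proj_mul (a := a.+1) (b := b.+1); first by rewrite ?ltnS ?bs ?(ltnW ab).
have [|-> ->] := chain_proj_mul (a := a) (b := b.+1); first by rewrite ?ltnS ?bs ?leqW ?(ltnW ab).
have [|-> ->] := chain_proj_mul (a := a.+1) (b := b); first by rewrite ?ab ?leqW.
have [|-> ->] := chain_proj_mul (a := a) (b := b); first by rewrite ?(ltnW ab) ?leqW.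
by rewrite !subrr.
Qed.

Lemma chain_projE (a : nat) :
  chain_proj a = \sum_(0 <= b < a) layer_proj b.
Proof. by rewrite telescope_sumr //= subr0. Qed.

Lemma sum_layer_proj : \sum_(b < s.+1) layer_proj b = 1%:M.
Proof.
rewrite -(big_mkord xpredT layer_proj) -chain_projE /=.
exact: congruence_proj_id.
Qed.

Lemma mxtrace_layer_proj (b : nat) :
  \tr (layer_proj b) = if b is b'.+1 then p%:R ^+ b - p%:R ^+ b' else 1.
Proof.
rewrite /layer_proj raddfB /=; case: b => [|b] /=.
  by rewrite raddf0 subr0 mxtrace_congruence_proj // expn0.
by rewrite !mxtrace_congruence_proj // !natrX.
Qed.

End PrimePower.

(** * Eigenvalues and the energy formula for prime powers *)

Definition past_weight (R : realType) (p : nat) (c : nat -> bool) (a : nat) : R :=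
  \sum_(k < a) (c k)%:R * p%:R ^- (a - k).

Definition normalized_energy (R : realType) (p : nat) (c : nat -> bool) (s : nat) : R :=
  \sum_(a < s) (c a)%:R * (1 - (p%:R - 1) * past_weight R p c a).

Section EnergyPrimePower.
Variables (R : realType) (p s : nat).
Hypothesis p_prime : prime p.
Let n := (p ^ s)%N.
Let p_gt0 : (0 < p)%N := prime_gt0 p_prime.
Let pR_neq0 : p%:R != 0 :> R. Proof. by rewrite pnatr_eq0 -lt0n. Qed.

Lemma mem_proper_divisors (d : nat) :
  (d \in proper_divisors n) = [exists a : 'I_s, d == (p ^ a)%N].
Proof.
have n0 : (0 < n)%N by rewrite expn_gt0 p_gt0.
rewrite /proper_divisors !inE /= -dvdn_divisors //; apply/idP/existsP.
  move=> /andP[/(dvdn_pfactor _ _ p_prime)[a as' ->] ].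
  rewrite ltn_exp2l ?prime_gt1 // => ltas.
  by exists (Ordinal ltas).
by move=> [a /eqP ->]; rewrite dvdn_exp2l ?(ltnW (ltn_ord a)) //= ltn_exp2l ?prime_gt1.
Qed.

Variable D : {fset nat}.
Hypothesis D_sub : (D `<=` proper_divisors n)%fset.
Let c (a : nat) := (p ^ a)%N \in D.

(** [p%:R ^+ (s - a) *: chain_proj R p s a.+1] is the indicator matrix of p ^ a dividing i - j, and
    the gcd is p ^ a when p ^ a divides i - j but p ^ (a + 1) does not. *)
Lemma adjacency_layers :
  adjacency_mx R (icg (n := n) D) =
  \sum_(a < s) (c a)%:R *: (p%:R ^+ (s - a) *: chain_proj R p s a.+1
                            - p%:R ^+ (s - a.+1) *: chain_proj R p s a.+2).
Proof.
apply/matrixP => i j; rewrite summxE mxE /icg.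
set t := `|_|%N.
have congE a : (i == j %[mod p ^ a]) = (p ^ a %| t)%N.
  rewrite /t -eqz_nat -!modz_nat eqz_mod_dvd.
  by rewrite /dvdz.
have [e es gE] : exists2 e, (e <= s)%N & gcdn t n = (p ^ e)%N.
  by apply/(dvdn_pfactor _ _ p_prime); rewrite dvdn_gcdr.
have dvdE a : (a <= s)%N -> (p ^ a %| t)%N = (a <= e)%N.
  move=> as'; rewrite -(dvdn_Pexp2l _ _ (prime_gt1 p_prime)) -gE dvdn_gcd.
  by rewrite dvdn_exp2l ?andbT.
have chainE a : (a <= s)%N -> p%:R ^+ (s - a) * chain_proj R p s a.+1 i j = (a <= e)%:R.
  move=> as'; rewrite /= mxE congE dvdE // mulrA natrX natrX mulrA -exprD subnK //.
  by rewrite divff ?mul1r // expf_neq0.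
rewrite gE.
transitivity (\sum_(a < s) (c a)%:R * (a == e :> nat)%:R : R); last first.
  have entry (x y z : R) (M N : 'M[R]_n) :
      (z *: (x *: M - y *: N)) i j = z * (x * M i j - y * N i j) by rewrite !mxE.
  apply: eq_bigr => a _; rewrite entry !chainE ?(ltnW (ltn_ord a)) ?ltn_ord //.
  by case: (ltngtP a e) => _; rewrite ?subrr ?subr0.
(* On the diagonal the gcd is n itself, which [D] does not contain. *)
move: es; rewrite leq_eqVlt => /orP[/eqP es|es].
  rewrite es big1 => [|a _]; last by rewrite (ltn_eqF (ltn_ord a)) mulr0.
  case: (boolP (_ \in D)) => // /(fsubsetP D_sub).
  rewrite mem_proper_divisors => /existsP[a].
  by rewrite (eqn_exp2l _ _ (prime_gt1 p_prime)) (gtn_eqF (ltn_ord a)).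
rewrite (bigD1 (Ordinal es)) //= eqxx mulr1 big1 ?addr0 // => a.
by rewrite -val_eqE /= => /negPf ->; rewrite mulr0.
Qed.

(** [phi a] is Euler's totient of p ^ (s - a), the number of residues whose gcd with n is p ^ a. The
    divisor p ^ a alone has on layer b the eigenvalue [phi a] if b <= a, - p ^ (s - b) if b = a + 1,
    and 0 otherwise: a Ramanujan sum. [lam] adds these up over [D]. *)
Let phi (a : nat) : R := (p%:R - 1) * p%:R ^+ (s - a.+1).
Let tail (b : nat) : R := \sum_(a < s) (c a)%:R * phi a * (b <= a)%:R.
Let lam (b : nat) : R :=
  tail b - (if b is b'.+1 then (c b')%:R * p%:R ^+ (s - b) else 0).

Lemma adjacency_spectral :
  adjacency_mx R (icg (n := n) D) = \sum_(b < s.+1) lam b *: layer_proj R p s b.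
Proof.
have chain a : (a < s.+1)%N ->
    chain_proj R p s a.+1 = \sum_(b < s.+1) (b <= a)%:R *: layer_proj R p s b.
  move=> as'; rewrite chain_projE big_mkord (big_ord_widen _ (layer_proj R p s) as').
  rewrite big_mkcond; apply: eq_bigr => b _; rewrite ltnS.
  by case: leqP; rewrite ?scale1r ?scale0r.
rewrite adjacency_layers.
under eq_bigr => a _ do rewrite !chain ?ltnS ?(ltnW (ltn_ord a)) // !scaler_sumr -sumrB scaler_sumr.
rewrite exchange_big; apply: eq_bigr => b _ /=.
under eq_bigr => a _ do rewrite !scalerA -scalerBl scalerA.
rewrite -scaler_suml; congr (_ *: _); rewrite /lam /tail.
transitivity (\sum_(a < s) ((c a)%:R * phi a * (b <= a)%:R -
    (c a)%:R * p%:R ^+ (s - a.+1) * (b == a.+1 :> nat)%:R) : R).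
  apply: eq_bigr => a _; rewrite /phi.
  rewrite [(s - a)%N](_ : _ = (s - a.+1).+1) ?exprS; last by rewrite subnSK.
  by rewrite -(ltnS b a); case: (ltngtP b a.+1) => _ /=; ring.
rewrite sumrB; congr (_ - _); case: b => [[|b] bs] /=.
  by rewrite big1 // => a _; rewrite mulr0.
rewrite (bigD1 (Ordinal (bs : b < s)%N)) //= eqxx mulr1 big1 ?addr0 // => a.
by rewrite -val_eqE eqSS eq_sym /= => /negPf ->; rewrite mulr0.
Qed.

(** All [phi a] with b <= a < s telescope to p ^ (s - b) - 1. The bounds decide the sign of
    [lam b.+1]: nonpositive if [c b] holds, nonnegative if not. *)
Lemma tail_bound (b : nat) : (b <= s)%N -> 0 <= tail b <= p%:R ^+ (s - b).
Proof.
have p1 : 1 <= p%:R :> R by rewrite ler1n.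
have phi0 a : 0 <= phi a by rewrite mulr_ge0 ?subr_ge0 ?exprn_ge0 ?ler0n.
move=> bs; apply/andP; split.
  by apply: sumr_ge0 => a _; apply: mulr_ge0 (mulr_ge0 (ler0n _ _) (phi0 _)) (ler0n _ _).
apply: (@le_trans _ _ (\sum_(b <= a < s) phi a)).
  rewrite big_geq_mkord [leRHS]big_mkcond /=; apply: ler_sum => a _.
  case: (b <= a)%N; rewrite ?mulr0 ?mulr1 //; case: (c a); rewrite ?mul1r ?mul0r //.
rewrite (telescope_sumr_eq (fun a => - p%:R ^+ (s - a))) //.
  by rewrite subnn expr0 opprK addrC gerDl oppr_le0 ler01.
move=> a /andP[_ as']; rewrite /phi -(subnSK as') exprS.
by ring.
Qed.

Lemma normalize_icg_energy :
  (0 < s)%N -> normalize p s (icg_energy R n D) = normalized_energy R p c s.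
Proof.
move=> s0; rewrite /icg_energy.
rewrite (@graph_energy_spectral _ _ s.+1 _ (fun b => layer_proj R p s b) (fun b => lam b)).
- rewrite /normalize /normalized_energy.
  under eq_bigr => b _ do rewrite mxtrace_layer_proj //.
  rewrite big_ord_recl /= mul1r {1}/lam /= subr0 ger0_norm; last first.
    by case/andP: (tail_bound (leq0n s)).
  pose w (b : nat) : R := p%:R ^+ b.+1 - p%:R ^+ b.
  have absE (b : 'I_s) : w b * `|lam b.+1| =
      w b * tail b.+1 + (w b * (c b)%:R * p%:R ^+ (s - b.+1)
                         - 2 * (w b * (c b)%:R * tail b.+1)).
    have /andP[t0 t1] := tail_bound (ltn_ord b).
    rewrite /lam; case: (c b); rewrite /= ?mul0r ?subr0 ?mul1r.
      by rewrite ler0_norm ?subr_le0 //; ring.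
    by rewrite ger0_norm //; ring.
  rewrite (eq_bigr _ (fun b _ => absE b)) !big_split /= sumrN.
  have restrict (f : nat -> R) (a : 'I_s) :
      \sum_(b < s) f b * (b < a)%:R = \sum_(b < a) f b.
    rewrite (big_ord_widen _ f (ltnW (ltn_ord a))) [RHS]big_mkcond /=.
    by apply: eq_bigr => b _; case: (_ < _)%N; rewrite ?mulr1 ?mulr0.
  (* Exchanging the sums collects everything by exponents a of [D] instead of layers. *)
  have tailE (f : nat -> R) : \sum_(b < s) f b * tail b.+1 =
      \sum_(a < s) (c a)%:R * phi a * \sum_(b < a) f b.
    rewrite /tail; under eq_bigr => b _ do rewrite mulr_sumr.
    rewrite exchange_big /=; apply: eq_bigr => a _; rewrite -restrict mulr_sumr.
    by apply: eq_bigr => b _; ring.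
  rewrite -mulr_sumr (tailE w) (tailE (fun b => w b * (c b)%:R)).
  have Z0 : 2 * (p%:R - 1) * p%:R ^+ s.-1 != 0 :> R.
    have p1 : p%:R - 1 != 0 :> R.
      by rewrite subr_eq0 pnatr_eq1 (gtn_eqF (prime_gt1 p_prime)).
    exact: mulf_neq0 (mulf_neq0 (negbT (pnatr_eq0 _ 2)) p1) (expf_neq0 _ pR_neq0).
  apply: (canLR (mulfK Z0)).
  rewrite {1}/tail mulr_sumr mulr_suml -sumrB -!big_split /=.
  apply: eq_bigr => a _; rewrite mulr1.
  rewrite -(big_mkord xpredT w) telescope_sumr // expr0.
  (* The traces of the layers 0, ..., a - 1, together with w a replaced by its own terms below, lead
     to the product p ^ a * phi a; it is the same for all a, namely half the normalizing
     denominator. *)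
  have phiE : p%:R ^+ a * phi a = (p%:R - 1) * p%:R ^+ s.-1.
    rewrite /phi mulrCA -exprD; congr (_ * _ ^+ _).
    by have := ltn_ord a; lia.
  have wE : phi a * (\sum_(b < a) w b * (c b)%:R) =
      (p%:R - 1) * p%:R ^+ s.-1 * ((p%:R - 1) * past_weight R p c a).
    rewrite /past_weight !mulr_sumr; apply: eq_bigr => b _.
    rewrite -phiE /w exprS -[in p%:R ^+ a](subnK (ltnW (ltn_ord b))) exprD.
    by field; rewrite expf_neq0.
  have -> : w a * (c a)%:R * p%:R ^+ (s - a.+1) = (c a)%:R * (p%:R ^+ a * phi a).
    by rewrite /w /phi exprS; ring.
  set X := \sum_(b < a) _ in wE *; move: wE phiE.
  set W := past_weight _ _ _ _; set Z := p%:R ^+ s.-1; set Y := p%:R ^+ a.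
  move=> wE phiE.
  transitivity ((c a)%:R * (2 * (Y * phi a) - 2 * (phi a * X))); first by ring.
  by rewrite wE phiE; ring.
- by move=> i; apply: layer_proj_idem; rewrite // -ltnS.
- move=> i j; rewrite -val_eqE neq_ltn => /orP[ij|ji].
    by have [|-> _] := @layer_proj_orth R p s p_prime i j; first by rewrite ij -ltnS ltn_ord.
  by have [|_ ->] := @layer_proj_orth R p s p_prime j i; first by rewrite ji -ltnS ltn_ord.
- exact: sum_layer_proj.
- exact: adjacency_spectral.
Qed.
End EnergyPrimePower.

(** * Upper and lower bounds for the normalized energy *)

Section NormalizedEnergy.
Variables (R : realType) (p : nat) (c : nat -> bool).
Hypothesis p_gt1 : (1 < p)%N.
Let T := past_weight R p c.
Let pR_gt1 : 1 < p%:R :> R. Proof. by rewrite ltr1n. Qed.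

Lemma past_weightS (a : nat) : T a.+1 = (T a + (c a)%:R) / p%:R.
Proof.
rewrite /T /past_weight big_ord_recr /= subSnn expr1 mulrDl mulr_suml; congr (_ + _).
apply: eq_bigr => k _; rewrite subSn ?(ltnW (ltn_ord k)) // exprS invfM.
by rewrite mulrA mulrAC.
Qed.

Lemma past_weight_ge0 (a : nat) : 0 <= T a.
Proof.
by apply: sumr_ge0 => k _; rewrite mulr_ge0 ?invr_ge0 ?exprn_ge0 ?ler0n.
Qed.

Lemma normalized_energyS (s : nat) :
  normalized_energy R p c s.+1 =
  normalized_energy R p c s + (c s)%:R * (1 - (p%:R - 1) * T s).
Proof. by rewrite /normalized_energy big_ord_recr. Qed.

(** If the last two exponents are both chosen, the last one adds at most 1 / 2, because its loss is
    at least (p - 1) / p >= 1 / 2. Otherwise the last two together add at most 1, or the last one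
    adds nothing. *)
Lemma normalized_energy_upper (s : nat) :
  normalized_energy R p c s <= (s%:R + 1) / 2.
Proof.
have step t : normalized_energy R p c t.+1 <= normalized_energy R p c t + 1.
  rewrite normalized_energyS lerD2l; case: (c t); rewrite ?mul0r ?mul1r ?ler01 //=.
  by rewrite gerBl mulr_ge0 ?past_weight_ge0 // subr_ge0 ltW.
elim/ltn_ind: s => -[|[|s]] IHs.
- by rewrite /normalized_energy big_ord0; lra.
- by have := step 0%N; rewrite {2}/normalized_energy big_ord0; lra.
have := IHs s; have := IHs s.+1; rewrite !ltnS leqnn leqnSn => /(_ isT) h1 /(_ isT) h0.
have st := step s.
have -> : s.+2%:R = s%:R + 2 :> R by rewrite -addn2 natrD.
have e1 : s.+1%:R = s%:R + 1 :> R by rewrite -addn1 natrD.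
rewrite e1 in h1; rewrite normalized_energyS past_weightS.
case: (c s.+1); rewrite ?mul0r ?mul1r /=; last by lra.
have T0 := past_weight_ge0 s; have p1R := pR_gt1.
case cs : (c s) => /=.
  have : (p%:R - 1) * ((T s + 1) / p%:R) >= 1 / 2 :> R.
    rewrite mulrA ler_pdivlMr; last by lra.
    have : (2 : R) <= p%:R by rewrite (ler_nat R 2 p).
    by move=> p2; nra.
  by lra.
have : normalized_energy R p c s.+1 = normalized_energy R p c s.
  by rewrite normalized_energyS cs mul0r addr0.
have : 0 <= (p%:R - 1) * ((T s + 0) / p%:R).
  by rewrite mulr_ge0 ?divr_ge0 //; lra.
by lra.
Qed.

Variable g : nat.
Hypothesis g_gt0 : (0 < g)%N.
Hypothesis c_spaced : forall k a, (k < a)%N -> c k -> c a -> (k + g <= a)%N.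

Let pg_gt1 : 1 < p%:R ^+ g :> R.
Proof. by rewrite exprn_egt1 // -lt0n. Qed.

(* The bound is attained in the limit by the progression ..., a - d - g, a - d. *)
Lemma past_weight_gap (a d : nat) :
  (forall k, (k < a)%N -> c k -> (k + d <= a)%N) ->
  T a <= p%:R ^- d * (p%:R ^+ g / (p%:R ^+ g - 1)).
Proof.
have p1R := pR_gt1; have pg1 := pg_gt1.
set y : R := p%:R ^+ g / _.
have y0 : 0 < y by rewrite divr_gt0; lra.
have p0 : 0 < p%:R :> R by lra.
elim: a d => [|a IHa] d gap.
  by rewrite /T /past_weight big_ord0 mulr_ge0 ?invr_ge0 ?exprn_ge0 // ltW.
rewrite past_weightS; case ca : (c a).
  (* As [a] itself is chosen, the distance to [a.+1] is only 1. *)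
  have d1 : (d <= 1)%N by have := gap a (ltnSn a) ca; lia.
  have Ta : T a <= p%:R ^- g * y by apply: IHa => k ka ck; apply: c_spaced.
  (* [y] is the sum of the geometric series in p ^ (- g), hence the fixed point of y = p ^ (- g) * y
     + 1. *)
  have e1 : T a + 1 <= y.
    have -> : y = p%:R ^- g * y + 1; last by rewrite lerD2r.
    by rewrite /y; field; rewrite !gt_eqF //; lra.
  apply: (@le_trans _ _ (y / p%:R)); first by rewrite ler_pM2r ?invr_gt0.
  rewrite mulrC ler_pM2r //; case: d d1 {gap} => [|[|//]] _.
    by rewrite expr0 invr1 invf_le1 // ltW.
  by rewrite expr1.
rewrite addr0 ler_pdivrMr //; case: d gap => [|d] gap.
  rewrite expr0 invr1 mul1r; apply: le_trans (IHa 0%N _) _.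
    by move=> k ka _; rewrite addn0 ltnW.
  by rewrite expr0 invr1 mul1r ler_peMr // ltW.
apply: le_trans (IHa d _) _.
  by move=> k ka ck; have := gap k (ltnW ka) ck; lia.
rewrite [leRHS](_ : _ = p%:R ^- d * y) //.
by rewrite exprS; field; rewrite !gt_eqF ?exprn_gt0.
Qed.

(** The first chosen exponent loses nothing; by [past_weight_gap] with d = g, each later one loses
    at most (p - 1) / (p ^ g - 1). *)
Lemma normalized_energy_spaced (s : nat) :
  let r := (\sum_(a < s) c a)%N in
  r%:R - r.-1%:R * ((p%:R - 1) / (p%:R ^+ g - 1)) <= normalized_energy R p c s.
Proof.
have p1R := pR_gt1; have pg1 := pg_gt1.
elim: s => [|s] /=; first by rewrite /normalized_energy !big_ord0 /= mul0r subr0.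
rewrite big_ord_recr /= normalized_energyS; set r := (\sum_(a < s) c a)%N => IHs.
case cs : (c s); rewrite /= ?addn0 ?mul0r ?addr0 // addn1 mul1r /=.
have [r0|r0] := posnP r.
  have -> : T s = 0.
    rewrite /T /past_weight big1 // => k _; move: r0 => /eqP.
    by rewrite sum_nat_eq0 => /forallP/(_ k)/= ; case: (c k); rewrite ?mul0r.
  by move: IHs; rewrite r0 /=; lra.
have Ts : (p%:R - 1) * T s <= (p%:R - 1) / (p%:R ^+ g - 1).
  apply: ler_wpM2l; first by rewrite subr_ge0 ltW.
  have -> : (p%:R ^+ g - 1)^-1 = p%:R ^- g * (p%:R ^+ g / (p%:R ^+ g - 1)) :> R.
    by field; rewrite !gt_eqF //; lra.
  by apply: past_weight_gap => k ks ck; apply: c_spaced.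
set th := (p%:R - 1) / _ in IHs Ts *.
have -> : r.+1%:R = r%:R + 1 :> R by rewrite -addn1 natrD.
have : r%:R = r.-1%:R + 1 :> R by rewrite -{1}(prednK r0) -addn1 natrD.
by move=> e; rewrite e in IHs *; lra.
Qed.

End NormalizedEnergy.

(** * Divisor sets with spaced exponents *)

Lemma step_spaced (b : nat -> nat) (g r : nat) :
  (forall j, (j.+1 < r)%N -> (b j + g <= b j.+1)%N) ->
  forall i j, (i < j < r)%N -> (b i + g <= b j)%N.
Proof.
move=> stepb i; elim=> [|j IHj] // /andP[ij jr].
move: ij; rewrite ltnS leq_eqVlt => /orP[/eqP ->|ij]; first exact: stepb.
have := IHj; rewrite ij (ltnW jr) => /(_ isT); have := stepb j jr; lia.
Qed.

Lemma icg_energy_spaced (R : realType) (p s g r : nat) (b : nat -> nat)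
    (D : {fset nat}) :
  prime p -> (0 < g)%N -> (0 < r)%N ->
  (forall j, (j.+1 < r)%N -> (b j + g <= b j.+1)%N) ->
  (b r.-1 < s)%N ->
  (forall d, d \in D <-> exists2 j, (j < r)%N & d = (p ^ b j)%N) ->
  (D `<=` proper_divisors (p ^ s))%fset /\
  r%:R - r.-1%:R * ((p%:R - 1) / (p%:R ^+ g - 1)) <=
    normalize p s (icg_energy R (p ^ s) D).
Proof.
move=> pp g0 r0 stepb bs memD.
have p1 := prime_gt1 pp.
have spb := step_spaced stepb.
have b_lt j : (j < r)%N -> (b j < s)%N.
  move=> jr; have [->//|jr1] := eqVneq j r.-1.
  by have := spb j r.-1; lia.
have Dsub : (D `<=` proper_divisors (p ^ s))%fset.
  apply/fsubsetP => d /memD[j jr ->]; rewrite mem_proper_divisors //.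
  by apply/existsP; exists (Ordinal (b_lt j jr)).
split=> //; rewrite normalize_icg_energy //; last exact: leq_ltn_trans bs.
pose c a := (p ^ a)%N \in D.
have cP a : c a <-> exists2 j, (j < r)%N & a = b j.
  rewrite /c memD; split=> -[j jr e]; exists j => //; last by rewrite e.
  exact: (expnI p1 e).
have spaced k a : (k < a)%N -> c k -> c a -> (k + g <= a)%N.
  move=> ka /cP[i ir ei] /cP[j jr ej].
  have [ij|ji|ij] := ltngtP i j.
  - by rewrite ei ej spb ?ij.
  - by have := spb j i; rewrite ji ir => /(_ isT); lia.
  - by move: ka; rewrite ei ej ij ltnn.
apply: le_trans (normalized_energy_spaced R p1 g0 spaced s).
set t := (\sum_(a < s) _)%N.
(* A lower estimate of the number [t] of exponents suffices, because each one contributes at least 1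
   - th >= 0. *)
have rt : (r <= t)%N.
  have ub : uniq [seq b j | j <- iota 0 r].
    rewrite map_inj_in_uniq ?iota_uniq // => i j; rewrite !mem_iota /= !add0n => ir jr e.
    have [ij|ji|//] := ltngtP i j.
    - by have := spb i j; rewrite ij jr => /(_ isT); lia.
    - by have := spb j i; rewrite ji ir => /(_ isT); lia.
  rewrite -(size_iota 0 r) -(size_map b).
  have -> : t = size [seq a <- iota 0 s | c a].
    rewrite size_filter -sum1_count /t -(big_mkord xpredT (fun a => nat_of_bool (c a))).
    by rewrite [RHS]big_mkcond /index_iota subn0; apply: eq_bigr => a _; case: (c a).
  apply: uniq_leq_size => // a /mapP[j]; rewrite mem_iota add0n /= => jr ->.
  rewrite mem_filter mem_iota add0n /= b_lt // andbT.
  by apply/cP; exists j.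
have th1 : (p%:R - 1) / (p%:R ^+ g - 1) <= 1 :> R.
  have pR : 1 < p%:R :> R by rewrite ltr1n.
  have pg : p%:R <= p%:R ^+ g :> R by rewrite ler_eXnr // ltW.
  by rewrite ler_pdivrMr; lra.
set th := _ / _ in th1 *.
have e (m : nat) : (0 < m)%N -> m%:R = m.-1%:R + 1 :> R.
  by move=> m0; rewrite -{1}(prednK m0) -addn1 natrD.
rewrite (e r r0) (e t (leq_trans r0 rt)).
have : r.-1%:R <= t.-1%:R :> R by rewrite ler_nat; lia.
by nra.
Qed.

(** * Numerical bounds for logarithms and for the ratio log log p / log p *)

Section LogBounds.
Variable R : realType.
Implicit Types x q : R.

(** From (1 - q / n) ^ n <= exp (- q). This reduces bounds on logarithms to rational arithmetic, as
    does [ln_upper] with (1 + q / n) ^ n <= exp q. *)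
Lemma ln_lower x q (n : nat) :
  (0 < n)%N -> 0 < x -> q < n%:R -> 1 <= x * (1 - q / n%:R) ^+ n -> q <= ln x.
Proof.
move=> n0 x0 qn h.
have nR : 0 < n%:R :> R by rewrite ltr0n.
have h1 : 0 <= 1 - q / n%:R by rewrite subr_ge0 ler_pdivrMr // mul1r ltW.
have h2 : (1 - q / n%:R) ^+ n <= expR (- q).
  have -> : - q = - (q / n%:R) * n%:R by rewrite mulNr divfK ?gt_eqF.
  by rewrite expRM_natr lerXn2r ?nnegrE ?expR_ge0 ?expR_ge1Dx.
rewrite -ler_expR lnK ?posrE // -[expR q]mul1r.
rewrite -ler_pdivlMr ?expR_gt0 // -expRN.
by apply: le_trans h _; rewrite ler_pM2l.
Qed.

Lemma ln_upper x q (n : nat) :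
  (0 < n)%N -> 0 < x -> 0 <= 1 + q / n%:R -> x <= (1 + q / n%:R) ^+ n -> ln x <= q.
Proof.
move=> n0 x0 h1 h.
have nR : 0 < n%:R :> R by rewrite ltr0n.
rewrite -ler_expR lnK ?posrE //; apply: le_trans h _.
have {2}-> : q = q / n%:R * n%:R by rewrite divfK ?gt_eqF.
by rewrite expRM_natr lerXn2r ?nnegrE ?expR_ge0 ?expR_ge1Dx.
Qed.

Lemma ln_tangent x q : 0 < x -> 0 < q -> ln x <= x / q - 1 + ln q.
Proof.
move=> x0 q0; rewrite -lerBlDr -ln_div ?posrE //.
have := @le_ln1Dx R (x / q - 1); rewrite [1 + _]addrC subrK; apply.
by have := divr_gt0 x0 q0; lra.
Qed.

Lemma ln2_lower : 3 / 5 <= ln 2 :> R.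
Proof. by apply: (@ln_lower _ _ 3) => //; lra. Qed.

(** The precision is dictated by [loglog_ratio2_upper], which needs log 2 <= 2 ^ (- 21 / 40), about
    0.69496. *)
Lemma ln2_upper : ln 2 <= 1389 / 2000 :> R.
Proof.
pose x : R := 1 + (1389 / 2000) / 256.
have step (a b : R) (n : nat) : 0 <= b -> b <= a ^+ 2 -> 0 <= a ->
    a <= x ^+ n -> b <= x ^+ (n * 2).
  move=> b0 ba a0 an; apply: le_trans ba _.
  by rewrite exprM lerXn2r // nnegrE (le_trans a0).
(* Repeated squaring of x, each value rounded down. *)
apply: (@ln_upper 2 _ 256 isT); [by [] | lra |].
apply: (step (1 + 414 / 10 ^+ 3 + 472 / 10 ^+ 6) _ 128%N); [lra | lra | lra |].
apply: (step (1 + 189 / 10 ^+ 3 + 316 / 10 ^+ 6) _ 64%N); [lra | lra | lra |].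
apply: (step (1 + 90 / 10 ^+ 3 + 558 / 10 ^+ 6) _ 32%N); [lra | lra | lra |].
apply: (step (1 + 44 / 10 ^+ 3 + 298 / 10 ^+ 6) _ 16%N); [lra | lra | lra |].
apply: (step (1 + 219 / 10 ^+ 4 + 92 / 10 ^+ 7) _ 8%N); [lra | lra | lra |].
apply: (step (1 + 108 / 10 ^+ 4 + 953 / 10 ^+ 7) _ 4%N); [lra | lra | lra |].
apply: (step (1 + 54 / 10 ^+ 4 + 329 / 10 ^+ 7) _ 2%N); [lra | lra | lra |].
apply: (step (1 + 27 / 10 ^+ 4 + 128 / 10 ^+ 7) _ 1%N); [lra | lra | lra |].
by rewrite expr1 /x; lra.
Qed.

Lemma ln3_lower : 1056 / 1000 <= ln 3 :> R.
Proof. by apply: (@ln_lower _ _ 16) => //; lra. Qed.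

Lemma ln3_upper : ln 3 <= 6 / 5 :> R.
Proof. by apply: (@ln_upper _ _ 8) => //; lra. Qed.

Lemma ln5_lower : 3 / 2 <= ln 5 :> R.
Proof. by apply: (@ln_lower _ _ 15) => //; lra. Qed.

Lemma ln13_lower : 12 / 5 <= ln 13 :> R.
Proof. by apply: (@ln_lower _ _ 24) => //; lra. Qed.

Lemma ln_nat_lower (k p : nat) q : (0 < k <= p)%N -> q <= ln k%:R -> q <= ln p%:R :> R.
Proof.
move=> /andP[k0 kp] /le_trans; apply.
by rewrite ler_ln ?posrE ?ltr0n ?ler_nat // (leq_trans k0).
Qed.

Lemma loglog_ratio2_lower : - (3 / 4) <= loglog_ratio R 2.
Proof.
have l2 := ln2_lower; have l0 : 0 < ln 2 :> R by lra.
rewrite /loglog_ratio ler_pdivlMr //.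
have h1 : ln (3 / 5) <= ln (ln 2) :> R by rewrite ler_ln ?posrE //; lra.
(* (3 / 5) ^ 4 * 2 ^ 3 = 1.0368 exceeds 1, so log (3 / 5) >= - (3 / 4) log 2. *)
have h2 : 0 <= ln ((3 / 5) ^+ 4 * 2 ^+ 3) :> R by rewrite ln_ge0 //; lra.
move: h2; rewrite lnM ?posrE ?exprn_gt0 ?divr_gt0 // !lnXn ?divr_gt0 //.
by lra.
Qed.

(** The constant 0.328 requires a ratio of at most 1 - 1 / 0.656, about -0.5244, while the true
    value is about -0.5288. The claim amounts to (log 2) ^ 40 * 2 ^ 21 <= 1, shown by repeated
    squaring with upward rounding. *)
Lemma loglog_ratio2_upper : loglog_ratio R 2 <= - (21 / 40).
Proof.
have l2 := ln2_lower; have l3 := ln2_upper; have l0 : 0 < ln 2 :> R by lra.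
rewrite /loglog_ratio ler_pdivrMr //; set l : R := ln 2 in l2 l3 l0 *.
have h1 : l ^+ 40 * 2 ^+ 21 <= 1.
  have sq a b (n m : nat) : (m = n * 2)%N -> 0 <= a -> l ^+ n <= a -> a ^+ 2 <= b -> l ^+ m <= b.
    move=> -> a0 la; apply: le_trans; rewrite exprM lerXn2r // nnegrE.
    by rewrite exprn_ge0 // ltW.
  have h5 : l ^+ 5 <= 1616 / 10 ^+ 4.
    apply: (@le_trans _ _ ((1389 / 2000) ^+ 5)); last by lra.
    by apply: lerXn2r l3; rewrite nnegrE; lra.
  have h10 : l ^+ 10 <= 2612 / 10 ^+ 5 by apply: (sq _ _ _ _ erefl _ h5); clear; lra.
  have h20 : l ^+ 20 <= 683 / 10 ^+ 6 by apply: (sq _ _ _ _ erefl _ h10); clear; lra.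
  have h40 : l ^+ 40 <= 4665 / 10 ^+ 10 by apply: (sq _ _ _ _ erefl _ h20); clear; lra.
  by rewrite -ler_pdivlMr ?exprn_gt0 //; apply: le_trans h40 _; lra.
have h2 := ln_le0 h1; move: h2; rewrite lnM ?posrE ?exprn_gt0 // !lnXn //.
by rewrite -/l; lra.
Qed.

Lemma loglog_ratio_ge0 (p : nat) : (3 <= p)%N -> 0 <= loglog_ratio R p.
Proof.
move=> p3; have l3 : 1056 / 1000 <= ln p%:R :> R.
  by apply: (@ln_nat_lower 3); rewrite ?ln3_lower.
by apply: divr_ge0; [apply: ln_ge0 |]; lra.
Qed.

(** The tangent of the logarithm at 2 has slope 1 / 2 and a negative intercept, since log 2 < 1. *)
Lemma loglog_ratio_lt (p : nat) : (2 <= p)%N -> loglog_ratio R p < 1 / 2.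
Proof.
move=> p2; have l2 : 3 / 5 <= ln p%:R :> R.
  by apply: (@ln_nat_lower 2); rewrite ?ln2_lower.
have l0 : 0 < ln p%:R :> R by lra.
rewrite /loglog_ratio ltr_pdivrMr //.
have := @ln_tangent (ln p%:R) 2 l0 (ltr0n _ 2).
by have := ln2_upper; lra.
Qed.

(** The value 1 / 3 separates log p / (p + 1) from log log p. The left side is the loss per exponent
    for gap 2, see [step2_loss]. *)
Lemma loglog_ratio_ge_inv (p : nat) :
  (5 <= p)%N -> 1 / p.+1%:R <= loglog_ratio R p.
Proof.
rewrite -(addn1 p) natrD => p5; have l5 : 3 / 2 <= ln p%:R :> R.
  by apply: (@ln_nat_lower 5); rewrite ?ln5_lower.
have p0 : 5 <= p%:R :> R by rewrite (ler_nat _ 5).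
have l0 : 0 < ln p%:R :> R by lra.
have h1 : ln p%:R <= (p%:R + 1) / 3 :> R.
  have := @ln_tangent p%:R 3; have := ln3_upper; lra.
have h2 : 1 - 1 / ln p%:R <= ln (ln p%:R) :> R.
  have := @ln_tangent (1 / ln p%:R) 1; rewrite ln1 divr_gt0 // => /(_ isT ltr01).
  by rewrite ln_div ?posrE // ln1; lra.
have h3 : 1 / 3 <= 1 - 1 / ln p%:R :> R.
  have : 1 / ln p%:R <= 2 / 3 :> R by rewrite ler_pdivrMr //; lra.
  by lra.
rewrite /loglog_ratio ler_pdivlMr // mulrAC ler_pdivrMr; last by lra.
by nra.
Qed.

(** Here log p <= (4 / 5) sqrt p, by the tangent at 3 applied to sqrt p, and log log p >= 4 / 5. *)
Lemma loglog_ratio_sqr_ge_inv (p : nat) :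
  (13 <= p)%N -> 1 / p.+1%:R <= loglog_ratio R p ^+ 2.
Proof.
rewrite -(addn1 p) natrD => p13; have l13 : 12 / 5 <= ln p%:R :> R.
  by apply: (@ln_nat_lower 13); rewrite ?ln13_lower.
have p0 : 13 <= p%:R :> R by rewrite (ler_nat _ 13).
have l0 : 0 < ln p%:R :> R by lra.
set y := Num.sqrt (p%:R : R).
have y2 : y ^+ 2 = p%:R by rewrite sqr_sqrtr; lra.
have y0 : 0 <= y by rewrite sqrtr_ge0.
have y3 : 3 <= y by nra.
have h1 : ln p%:R <= 4 / 5 * y :> R.
  rewrite -y2 lnXn; last by lra.
  have := @ln_tangent y 3; have := ln3_upper; lra.
have h2 : 4 / 5 <= ln (ln p%:R) :> R.
  apply: (@le_trans _ _ (ln (12 / 5))); last by rewrite ler_ln ?posrE //; lra.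
  by apply: (@ln_lower _ _ 8) => //; lra.
rewrite /loglog_ratio expr_div_n ler_pdivlMr ?exprn_gt0 // mulrAC ler_pdivrMr; last by lra.
rewrite mul1r; apply: (@le_trans _ _ ((4 / 5) ^+ 2 * p%:R)).
  by rewrite -[in leRHS]y2 -exprMn; apply: lerXn2r h1; rewrite nnegrE; nra.
apply: ler_pM; [by lra | by lra | | by lra].
have h3 : 0 <= ln (ln p%:R) :> R by lra.
by apply: lerXn2r h2; rewrite nnegrE; lra.
Qed.

End LogBounds.

(** * Rounding to a nearest integer *)

Section NearestInteger.
Variables (R : realType) (rnd : R -> int).
Hypothesis rndP : nearest_integer rnd.

Lemma nearest_integer_half (x : R) : `|x - (rnd x)%:~R| <= 1 / 2.
Proof.
have h1 := rndP x (Num.floor x); have h2 := rndP x (Num.floor x + 1).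
have f1 := floor_le_tmp x; have f2 := floorD1_gt x.
rewrite intrD in f2 h2; rewrite (ger0_norm (x := x - (Num.floor x)%:~R)) ?subr_ge0 // in h1.
rewrite [leRHS]ltr0_norm ?subr_lt0 // in h2; lra.
Qed.

Lemma nearest_integer_int (z : int) : rnd z%:~R = z.
Proof.
have := rndP z%:~R z; rewrite subrr normr0 normr_le0 subr_eq0 => /eqP/esym.
exact: intr_inj.
Qed.

(** Each rounding moves a number by at most 1 / 2, however ties are resolved, so the rounded gap
    exceeds k - 1. *)
Lemma nearest_integer_gap (x y : R) (k : nat) :
  x + k%:R < y -> rnd x + k%:Z <= rnd y.
Proof.
move=> xy; rewrite -ltzD1 -(ltr_int R) !intrD.
have := nearest_integer_half x; have := nearest_integer_half y.
by rewrite !ler_norml => /andP[? ?] /andP[? ?]; lra.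
Qed.

End NearestInteger.

(** * The gaps between the alphas and the set [D0] *)

Section Alpha.
Variables (R : realType) (p m r : nat).
Hypotheses (p_gt1 : (1 < p)%N) (r_ge3 : (3 <= r)%N).
Let nu := nu_tilde R p m r.

(** The difference of the two sides is -1 at 0 and p ^ m at 1, so a root exists and [xget] does not
    fall back on its default; neither endpoint is a root. *)
Lemma nu_tildeP : 0 < nu < 1 /\ p%:R ^+ m * nu ^+ r.-1 = (1 - nu) ^+ 2.
Proof.
have pm : 0 < p%:R ^+ m :> R by rewrite exprn_gt0 // ltr0n ltnW.
have r1 : (0 < r.-1)%N by lia.
have [nu01 eq] : 0 <= nu <= 1 /\ p%:R ^+ m * nu ^+ r.-1 = (1 - nu) ^+ 2.
  apply: (@xgetPex R 0 [set x : R | 0 <= x <= 1 /\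
    p%:R ^+ m * x ^+ r.-1 = (1 - x) ^+ 2]%classic).
  pose P : {poly R} := (p%:R ^+ m) *: 'X^(r.-1) - (1 - 'X) ^+ 2.
  have PE x : P.[x] = p%:R ^+ m * x ^+ r.-1 - (1 - x) ^+ 2 by rewrite /P !hornerE.
  have [||x x01 /rootP] := @poly_ivt R P 0 1.
  - exact: ler01.
  - rewrite !PE expr0n gtn_eqF //= expr1n; apply/andP; split; first by lra.
    by lra.
  by rewrite PE => /eqP; rewrite subr_eq0 => /eqP e; exists x.
split=> //; move: nu01; rewrite !le_eqVlt => /andP[/orP[/eqP n0|->] /orP[/eqP n1|->]] //.
- by move: n1; rewrite -n0 => /eqP; rewrite eq_sym oner_eq0.
- move: eq; rewrite -n0 expr0n gtn_eqF // mulr0 subr0 expr1n => /eqP.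
  by rewrite eq_sym oner_eq0.
- by move: eq; rewrite n1 subrr expr1n mulr1 expr0n /= => e; rewrite e ltxx in pm.
Qed.

(** Logarithms of the defining equation. Divided by log p, it says that two outer gaps log_p (1 /
    mu) and r - 3 inner gaps log_p (1 / nu) add up to m; in particular the last gap equals the
    first. *)
Lemma nu_tilde_ln :
  m%:R * ln p%:R = r.-1%:R * - ln nu + 2 * ln (1 - nu) :> R.
Proof.
have [/andP[nu0 nu1] eq] := nu_tildeP.
have pR : 0 < p%:R :> R by rewrite ltr0n ltnW.
move: (congr1 (@ln R) eq).
rewrite lnM ?posrE ?exprn_gt0 // !lnXn ?subr_gt0 //.
by rewrite -[ln p%:R *+ _]mulr_natl -[ln nu *+ _]mulr_natl; lra.
Qed.

(** The hypothesis says (1 - nu) / nu > p ^ g, which is the claim for the outer gaps; the inner ones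
    are larger because 1 - nu < 1. *)
Lemma alpha_gap (g j : nat) :
  nu * (p%:R ^+ g + 1) < 1 -> (0 < j < r)%N ->
  alpha R p m r j + g%:R < alpha R p m r j.+1.
Proof.
move=> nug /andP[j0 jr].
have [/andP[nu0 nu1] _] := nu_tildeP; have logs := nu_tilde_ln.
have l0 : 0 < ln p%:R :> R by rewrite ln_gt0 // ltr1n.
have pR : 0 < p%:R :> R by rewrite ltr0n ltnW.
set l := ln p%:R in l0 logs.
have NE : ln (1 / nu) = - ln nu by rewrite ln_div ?posrE // ln1 sub0r.
have ME : ln (1 / mu_tilde R p m r) = ln (1 - nu) - ln nu.
  by rewrite /mu_tilde -/nu div1r invf_div ln_div ?posrE ?subr_gt0.
have Mg : g%:R * l < ln (1 - nu) - ln nu.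
  rewrite -ln_div ?posrE ?subr_gt0 // [_%:R * _]mulr_natl -lnXn // ltr_ln ?posrE ?exprn_gt0 //.
    by rewrite ltr_pdivlMr // mulrC; lra.
  by rewrite divr_gt0 // subr_gt0.
have MN : ln (1 - nu) < 0 by rewrite ln_lt0 //; lra.
have rE : r.-1%:R = r%:R - 1 :> R by rewrite -subn1 natrB // (leq_trans _ r_ge3).
rewrite rE in logs.
have jE : j.+1%:R = j%:R + 1 :> R by rewrite -addn1 natrD.
rewrite /alpha NE ME eqSS (gtn_eqF j0) -/l.
have [->|j1] := eqVneq j 1%N.
  have -> : (2 == r) = false by rewrite ltn_eqF.
  by rewrite subrr mul0r addr0 add0r ltr_pdivlMr.
rewrite (ltn_eqF jr); have [jr1|_] := eqVneq j.+1 r.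
  have jE' : j%:R = r%:R - 1 :> R by rewrite -jr1 jE; ring.
  rewrite jE' -(ltr_pM2r l0).
  rewrite [ltLHS](_ : _ = ln (1 - nu) - ln nu + (r%:R - 3) * - ln nu + g%:R * l).
    by lra.
  by field; rewrite gt_eqF.
have Ng : g%:R < - ln nu / l by rewrite ltr_pdivlMr //; lra.
by rewrite jE; move: (_ / l) Ng => X Ng; lra.
Qed.

End Alpha.

(** Dropping the negative term 2 log (1 - nu) from [nu_tilde_ln] gives nu < p ^ (- D). For p = 2, D
    > 4 yields nu < 1 / 16; for p >= 3, p ^ D = (p log p) ^ 2. *)
Lemma nu_tilde_upper (R : realType) (p m r : nat) :
  prime p -> (3 <= r)%N -> r.-1%:R * D_const R p < m%:R ->
  let g := if p == 2%N then 3%N else 2%N in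
  nu_tilde R p m r * (p%:R ^+ g + 1) < 1.
Proof.
move=> pp r3 rD /=; have p1 := prime_gt1 pp.
have [/andP[nu0 nu1] _] := nu_tildeP R m p1 r3.
have logs := nu_tilde_ln R m p1 r3.
set nu := nu_tilde R p m r in nu0 nu1 logs *.
have l0 : 0 < ln p%:R :> R by rewrite ln_gt0 // ltr1n.
have pR : 0 < p%:R :> R by rewrite ltr0n ltnW.
have MN : ln (1 - nu) < 0 by rewrite ln_lt0 //; lra.
have r0 : 0 < r.-1%:R :> R by rewrite ltr0n; lia.
have ND : D_const R p * ln p%:R < - ln nu.
  rewrite -(ltr_pM2l r0) mulrA; apply: (@lt_trans _ _ (m%:R * ln p%:R)).
    by rewrite ltr_pM2r.
  by rewrite logs; lra.
have [p2|p2] := eqVneq p 2%N.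
  move: ND; rewrite /D_const p2 eqxx => ND.
  have l2 := ln2_lower R.
  have : ln (nu * 2 ^+ 4) < 0 by rewrite lnM ?posrE ?exprn_gt0 // lnXn //; lra.
  rewrite -[X in _ < X](@ln1 R) ltr_ln ?posrE ?mulr_gt0 ?exprn_gt0 // => h.
  by lra.
have p3 : (3 <= p)%N by lia.
move: ND; rewrite /D_const (negPf p2) => ND.
have l3 : 1056 / 1000 <= ln p%:R :> R by apply: (@ln_nat_lower _ 3); rewrite ?ln3_lower.
have p3R : 3 <= p%:R :> R by rewrite (ler_nat _ 3).
have : ln (nu * (p%:R * ln p%:R) ^+ 2) < 0.
  rewrite lnM ?posrE ?exprn_gt0 ?mulr_gt0 // lnXn ?mulr_gt0 // lnM ?posrE //.
  move: ND; rewrite /loglog_ratio.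
  have -> : 2 * (1 + ln (ln p%:R) / ln p%:R) * ln p%:R =
      2 * (ln p%:R + ln (ln p%:R)) :> R by field; rewrite gt_eqF.
  by lra.
rewrite -[X in _ < X](@ln1 R) ltr_ln ?posrE ?mulr_gt0 ?exprn_gt0 ?mulr_gt0 //.
(* It remains that p ^ 2 + 1 <= (p log p) ^ 2. At p = 3 this asks for log 3 >= sqrt (10 / 9), about
   1.0541, whence the bound 1.056. *)
apply: le_lt_trans; rewrite ler_pM2l // exprMn; set l := ln _ in l0 l3 *.
have : (1056 / 1000) ^+ 2 <= l ^+ 2 by apply: lerXn2r l3; rewrite nnegrE; lra.
have : 9 <= p%:R ^+ 2 :> R by nra.
by nra.
Qed.

Lemma D0_energy (R : realType) (rnd : R -> int) (p s r g : nat) :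
  prime p -> (0 < s)%N -> (3 <= r)%N -> (0 < g)%N -> nearest_integer rnd ->
  nu_tilde R p s.-1 r * (p%:R ^+ g + 1) < 1 ->
  (D0 rnd p s.-1 r `<=` proper_divisors (p ^ s))%fset /\
  r%:R - r.-1%:R * ((p%:R - 1) / (p%:R ^+ g - 1)) <=
    normalize p s (icg_energy R (p ^ s) (D0 rnd p s.-1 r)).
Proof.
move=> pp s0 r3 g0 rndP nug; have p1 := prime_gt1 pp.
pose z j : int := rnd (alpha R p s.-1 r j).
have gap j : (0 < j < r)%N -> z j + g%:Z <= z j.+1.
  by move=> jr; apply: nearest_integer_gap => //; apply: alpha_gap.
(* The end points 0 and s - 1 are integers and stay fixed, so the rounded exponents remain between
   them. *)
have z1 : z 1%N = 0.
  exact: (nearest_integer_int rndP 0).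
have zr : z r = s.-1%:Z.
  rewrite /z /alpha eqxx [(r == 1)%N]gtn_eqF ?(leq_trans _ r3) //.
  exact: (nearest_integer_int rndP s.-1).
have z_ge0 j : (0 < j <= r)%N -> 0 <= z j.
  elim: j => [|[|j] IHj] // /andP[_ jr]; first by rewrite z1.
  by have := IHj (ltnW jr); have := gap j.+1 jr; lia.
apply: (@icg_energy_spaced R p s g r (fun j => `|z j.+1|%N)) => //.
- exact: leq_trans r3.
- move=> j jr; have := gap j.+1 jr; have := z_ge0 j.+1 (ltnW jr).
  have := z_ge0 j.+2 jr; lia.
- rewrite prednK ?(leq_trans _ r3) // zr; lia.
move=> d; rewrite /D0; split.
  move=> /imfsetP[j /=]; rewrite mem_iota => /andP[j0 jr] ->.
  by exists j.-1; rewrite ?prednK //; lia.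
move=> [j jr ->]; apply/imfsetP; exists j.+1 => //=.
by rewrite mem_iota /=; lia.
Qed.

(** * The energy interval for the maximum and for [D0] *)

Lemma step2_loss (R : realType) (p : nat) :
  (1 < p)%N -> (p%:R - 1) / (p%:R ^+ 2 - 1) = 1 / p.+1%:R :> R.
Proof.
move=> p1; have pR : 1 < p%:R :> R by rewrite ltr1n.
have -> : p%:R ^+ 2 - 1 = (p%:R - 1) * (p%:R + 1) :> R by ring.
by rewrite -(addn1 p) natrD; field; rewrite !gt_eqF //; lra.
Qed.

(** Since (s + 1) / 2 = (s - 1) / 2 + 1, it suffices that [C_upper] times 1 - log log p / log p is
    at least 1 / 2. *)
Lemma icg_energy_upper (R : realType) (p s : nat) (D : {fset nat}) :
  prime p -> (0 < s)%N -> (D `<=` proper_divisors (p ^ s))%fset ->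
  normalize p s (icg_energy R (p ^ s) D) <=
    C_upper R p * (s.-1%:R * (1 - loglog_ratio R p)) + 1.
Proof.
move=> pp s0 Dsub; rewrite normalize_icg_energy //.
apply: le_trans (normalized_energy_upper R _ (prime_gt1 pp) s) _.
have -> : s%:R = s.-1%:R + 1 :> R by rewrite -{1}(prednK s0) -addn1 natrD.
have m0 : 0 <= s.-1%:R :> R by rewrite ler0n.
have : 1 / 2 <= C_upper R p * (1 - loglog_ratio R p).
  rewrite /C_upper; have [->|p2] := eqVneq p 2%N.
    by have := loglog_ratio2_upper R; lra.
  by have := loglog_ratio_lt R (prime_gt1 pp); lra.
by nra.
Qed.

Lemma normalize_le (R : realType) (p s : nat) (x y : R) :
  prime p -> (normalize p s x <= normalize p s y) = (x <= y).
Proof.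
move=> pp; have pR : 1 < p%:R :> R by rewrite ltr1n prime_gt1.
rewrite /normalize ler_pM2r // invr_gt0 mulr_gt0 ?exprn_gt0 //; lra.
Qed.

Lemma max_energy_ge (R : realType) (n : nat) (D : {fset nat}) :
  (D `<=` proper_divisors n)%fset -> icg_energy R n D <= max_energy R n.
Proof.
by move=> Dsub; apply: (le_bigmax_seq 0 D xpredT); rewrite ?fpowersetE.
Qed.

Lemma max_energy_le (R : realType) (p s : nat) :
  prime p -> (0 < s)%N ->
  normalize p s (max_energy R (p ^ s)) <=
    C_upper R p * (s.-1%:R * (1 - loglog_ratio R p)) + 1.
Proof.
move=> pp s0; have pR : 1 < p%:R :> R by rewrite ltr1n prime_gt1.
have Z0 : 0 < 2 * (p%:R - 1) * p%:R ^+ s.-1 :> R.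
  by rewrite mulr_gt0 ?exprn_gt0 //; lra.
rewrite /normalize ler_pdivrMr // /max_energy big_seq_cond.
apply: bigmax_le => [|D]; rewrite -?ler_pdivrMr //.
  (* The default 0 of the maximum is the energy for the empty set of divisors. *)
  rewrite mul0r; apply: le_trans (icg_energy_upper R pp s0 (fsub0set _)).
  rewrite normalize_icg_energy ?fsub0set // /normalized_energy big1 // => a _.
  by rewrite in_fset0 mul0r.
by rewrite fpowersetE andbT => /(icg_energy_upper R pp s0).
Qed.

Lemma C_lower_bounds (R : realType) (p s : nat) : 0 <= C_lower R p s <= 1 / 2.
Proof. by rewrite /C_lower; do ! case: ifP => _; apply/andP; split; lra. Qed.

(** The exponents 0, 2, ..., 2 h give h + 1 - h * th with th = 1 / (p + 1). As m <= 2 h + 1, this is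
    at least (m / 2) (1 - th), and th is at most the ratio for p >= 5. *)
Lemma max_energy_lower (R : realType) (p s : nat) :
  prime p -> (0 < s)%N ->
  C_lower R p s * (s.-1%:R * (1 - loglog_ratio R p)) <=
    normalize p s (max_energy R (p ^ s)).
Proof.
move=> pp s0; have p1 := prime_gt1 pp.
set m := s.-1; pose h := m./2.
have hm : (h * 2 <= m <= h * 2 + 1)%N by rewrite /h; lia.
pose r := h.+1; pose D := [fset (p ^ (k * 2))%N | k in iota 0 r]%fset.
have memD d : d \in D <-> exists2 j, (j < r)%N & d = (p ^ (j * 2))%N.
  have memI j : (j \in iota 0 r) = (j < r)%N by rewrite mem_iota.
  split=> [/imfsetP[j jr ->]|[j jr ->]]; first by exists j; rewrite // -memI.
  by apply/imfsetP; exists j => //; apply: etrans (memI j) jr.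
have [||Dsub] := @icg_energy_spaced R p s 2 r (fun j => (j * 2)%N) D pp isT isT _ _ memD.
- by move=> j _; rewrite mulSn addnC.
- by rewrite /= -(prednK s0) ltnS; case/andP: hm.
rewrite step2_loss //= => low.
apply: le_trans (_ : _ <= normalize p s (icg_energy R (p ^ s) D)) _; last first.
  by rewrite normalize_le // max_energy_ge.
apply: le_trans low.
have hS : h.+1%:R = h%:R + 1 :> R by rewrite -addn1 natrD.
have h0 : 0 <= h%:R :> R by rewrite ler0n.
have mh : m%:R <= h%:R * 2 + 1 :> R by rewrite -natrM -(natrD _ _ 1) ler_nat; case/andP: hm.
have m0 : 0 <= m%:R :> R by rewrite ler0n.
rewrite hS; have [p2|p2] := eqVneq p 2%N.
  have := loglog_ratio2_lower R; rewrite /C_lower p2 /=; set t := loglog_ratio R 2.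
  move=> t0; have : m%:R * (1 - t) <= m%:R * (7 / 4) by apply: ler_wpM2l; lra.
  by lra.
(* For p = 3 the loss 1 / 4 exceeds the ratio, about 0.086. The values m <= 5 are checked singly
   against m / 2, with equality at m = 5. *)
have [p3|p3] := eqVneq p 3%N.
  have := @loglog_ratio_ge0 R p; have := @loglog_ratio_lt R p p1.
  rewrite p3 => t1 /(_ isT) t0; rewrite /C_lower /=; case: ifP => s6; last by nra.
  have m5 : (m <= 5)%N by rewrite /m; lia.
  apply: (@le_trans _ _ (1 / 2 * m%:R)); first by nra.
  by rewrite /h; move: (m) m5 => k; case: k => [|[|[|[|[|[|k]]]]]] => //= _; lra.
have p5 : (5 <= p)%N.
  by move: pp p2 p3; clear; case: p => [|[|[|[|[|p]]]]].
have t1 := @loglog_ratio_lt R p p1; have := loglog_ratio_ge_inv R p5.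
have /andP[c0 c1] := C_lower_bounds R p s.
have p5R : 5 <= p%:R :> R by rewrite (ler_nat _ 5).
have : 1 / p.+1%:R <= 1 :> R by rewrite ler_pdivrMr ?ltr0n // mul1r ler1n.
have : 0 <= 1 / p.+1%:R :> R by rewrite divr_ge0.
set th := 1 / _; set t := loglog_ratio R p in t1 *; set C := C_lower _ _ _ in c0 c1 *.
move=> th0 th1 tht.
apply: (@le_trans _ _ (1 / 2 * (m%:R * (1 - th)))); last by nra.
by apply: ler_pM => //; [rewrite mulr_ge0; lra | apply: ler_wpM2l; lra].
Qed.

(** For p >= 3 write t for the ratio. Then s - 1 <= 2 (1 + t) r turns the target into at most 2 C (1
    - t ^ 2) r, to be compared with the gain 1 - 1 / (p + 1) per exponent. *)
Lemma D0_energy_lower (R : realType) (p s r : nat) (rnd : R -> int) :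
  prime p -> nearest_integer rnd ->
  s.-1%:R / D_const R p <= r%:R -> r%:R < s.-1%:R / D_const R p + 1 ->
  (p = 2%N /\ (11 <= s)%N) \/ ((3 <= p)%N /\ (7 <= s)%N) ->
  (D0 rnd p s.-1 r `<=` proper_divisors (p ^ s))%fset /\
  C_lower R p s * (s.-1%:R * (1 - loglog_ratio R p)) <=
    normalize p s (icg_energy R (p ^ s) (D0 rnd p s.-1 r)).
Proof.
move=> pp rndP rlo rhi cases; have p1 := prime_gt1 pp.
have s0 : (0 < s)%N by lia.
have ps : p != 2%N -> (3 <= p)%N && (6 < s)%N.
  by case: cases => [[->]|[-> ->]].
have t_lt := @loglog_ratio_lt R p p1.
have t_ge0 : p != 2%N -> 0 <= loglog_ratio R p.
  by move=> p2; apply: loglog_ratio_ge0; case/andP: (ps p2).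
have D_gt0 : 0 < D_const R p.
  by rewrite /D_const; case: eqVneq => [_|/t_ge0]; lra.
rewrite ler_pdivrMr // in rlo.
have rhi' : (r%:R - 1) * D_const R p < s.-1%:R by rewrite -ltr_pdivlMr //; lra.
(* The bounds on s make (s - 1) / D exceed 2: D < 3 for p >= 3 because the ratio is below 1 / 2, and
   10 > 2 * 4.09184 for p = 2. *)
have r3 : (3 <= r)%N.
  rewrite -(ltr_nat R) -(ltr_pM2r D_gt0); apply: lt_le_trans rlo.
  case: cases => [[p2 s11]|[p3 s7]].
    have : 10 <= s.-1%:R :> R by rewrite (ler_nat _ 10); lia.
    by rewrite /D_const p2 eqxx; lra.
  have : 6 <= s.-1%:R :> R by rewrite (ler_nat _ 6); lia.
  by rewrite /D_const gtn_eqF //; lra.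
have rE : r%:R = r.-1%:R + 1 :> R by rewrite -[in LHS](prednK (ltn_trans _ r3)) // -addn1 natrD.
have r0 : 0 <= r.-1%:R :> R by rewrite ler0n.
have nu_up : r.-1%:R * D_const R p < s.-1%:R by move: rhi'; rewrite rE addrK.
have := nu_tilde_upper pp r3 nu_up.
set g := if _ then _ else _ => nug.
have g0 : (0 < g)%N by rewrite /g; case: ifP.
have [Dsub low] := D0_energy pp s0 r3 g0 rndP nug.
split=> //; apply: le_trans low; rewrite /g {g g0 nug}.
have m0 : 0 <= s.-1%:R :> R by rewrite ler0n.
have [p2|p2] := eqVneq p 2%N.
  move: rlo; have := loglog_ratio2_lower R.
  rewrite /C_lower /D_const p2 /= rE; set t := loglog_ratio R 2.
  have -> : (2 - 1) / (2 ^+ 3 - 1) = 1 / 7 :> R.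
    have -> : 2 ^+ 3 - 1 = 7 :> R by ring.
    by lra.
  move=> t0 rlo.
  (* 0.118 * (7 / 4) * 4.09184 is about 0.845, just below the gain 6 / 7 per exponent. *)
  have : s.-1%:R * (1 - t) <= s.-1%:R * (7 / 4) by apply: ler_wpM2l; lra.
  by lra.
rewrite step2_loss //; move: rlo; rewrite /D_const (negPf p2).
have t0 := t_ge0 p2; set t := loglog_ratio R p in t0 t_lt *; move=> rlo.
have /andP[p3 s7] := ps p2.
have p3R : 3 <= p%:R :> R by rewrite (ler_nat _ 3).
have th0 : 0 <= 1 / p.+1%:R :> R by rewrite divr_ge0.
have /andP[c0 c1] := C_lower_bounds R p s.
(* For p >= 13, 2 C <= 1 and t ^ 2 >= 1 / (p + 1). For p = 3, 5, 7, 11 already 2 C is at most 1 - 1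
   / (p + 1). *)
have key : C_lower R p s * 2 * (1 - t ^+ 2) <= 1 - 1 / p.+1%:R.
  have [p13|p13] := leqP 13 p.
    have := loglog_ratio_sqr_ge_inv R p13; rewrite -/t.
    have : 0 <= t ^+ 2 <= 1 by apply/andP; split; nra.
    set th := 1 / _ in th0 *; set C := C_lower _ _ _ in c0 c1 *; nra.
  apply: (@le_trans _ _ (C_lower R p s * 2)); first by nra.
  have s6 : (s <= 6)%N = false by rewrite leqNgt s7.
  have : p \in [:: 3; 5; 7; 11]%N.
    move: pp p13 p2; clear; by case: p => [|[|[|[|[|[|[|[|[|[|[|[|[|p]]]]]]]]]]]]].
  rewrite /C_lower s6 !inE => /or4P[] /eqP -> /=; lra.
apply: (@le_trans _ _ (r%:R * (1 - 1 / p.+1%:R))); last first.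
  by rewrite rE; move: th0; set th := 1 / _; lra.
apply: (@le_trans _ _ (r%:R * (C_lower R p s * 2 * (1 - t ^+ 2)))); last first.
  by apply: ler_wpM2l; rewrite ?ler0n.
have : 0 <= C_lower R p s * (1 - t) by rewrite mulr_ge0 //; lra.
set C := C_lower _ _ _ in c0 c1 *; move=> ct.
have := ler_wpM2l ct rlo; lra.
Qed.

Theorem theorem3 (R : realType) (p s : nat) (hp : prime p) (hs : (0 < s)%N) :
  in_energy_interval p s (normalize p s (max_energy R (p ^ s)))
  /\
  (forall (rnd : R -> int) (r0 : nat),
     nearest_integer rnd ->
     s.-1%:R / D_const R p <= r0%:R ->
     r0%:R < s.-1%:R / D_const R p + 1 ->
     (p = 2%N /\ (11 <= s)%N) \/ ((3 <= p)%N /\ (7 <= s)%N) ->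
     in_energy_interval p s
       (normalize p s (icg_energy R (p ^ s) (D0 rnd p s.-1 r0)))).
Proof.
split; first by split; [exact: max_energy_lower | exact: max_energy_le].
move=> rnd r0 rndP rlo rhi cases.
have [Dsub low] := D0_energy_lower hp rndP rlo rhi cases.
by split=> //; apply: icg_energy_upper.
Qed.
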